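(* Let $(X,d)$ be a complete metric space, let $A_1$ and $A_2$ be two nonempty closed subsets of $X$, and let $f,g:Y\to Y$ be two mappings, where $Y=A_1\cup A_2$. Suppose that the following conditions hold: (i) $g(A_1)$ and $g(A_2)$ are closed; (ii) $f(A_1)\subseteq g(A_2)$ and $f(A_2)\subseteq g(A_1)$; (iii) $g$ is one-to-one; (iv) there exists a function $\psi\in\Psi$ such that $$d(fx,fy)\le\psi\left(\max\left\{d(gx,gy),\frac{d(gx,fx)+d(gy,fy)}{2},\frac{d(gx,fy)+d(gy,fx)}{2}\right\}\right)\quad\text{for all }(x,y)\in A_1\times A_2.$$ Then $f$ and $g$ have a coincidence point $z\in A_1\cap A_2$. Further, if $f$ and $g$ commute at their coincidence points, then $f$ and $g$ have a unique common fixed point, and it belongs to $A_1\cap A_2$.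
   Context: $\Psi$ denotes the family of functions $\psi:[0,\infty)\to[0,\infty)$ that are nondecreasing and satisfy $\sum_{n=1}^{+\infty}\psi^n(t)<\infty$ for all $t>0$, where $\psi^n$ is the $n$-th iterate of $\psi$. Notation: $fx=f(x)$, $gx=g(x)$. A coincidence point of $f$ and $g$ is $z\in Y$ with $fz=gz$. A common fixed point is $z\in Y$ with $fz=gz=z$. ''$f$ and $g$ commute at their coincidence points'' means $f(g(x))=g(f(x))$ for every coincidence point $x$ of $f$ and $g$. *)

(* Defs.v *)
From HB Require Import structures.
From mathcomp Require Import all_boot all_order all_algebra.
From mathcomp Require Import all_classical all_reals all_analysis.

Set Implicit Arguments.
Unset Strict Implicit.
Unset Printing Implicit Defensive.

Import Order.TTheory GRing.Theory Num.Theory.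
Import numFieldNormedType.Exports.

Local Open Scope classical_set_scope.
Local Open Scope ring_scope.

(* [Complete] includes a base point, which is harmless for nonempty spaces. *)
#[short(type="completeMetricType")]
HB.structure Definition CompleteMetric (R : numDomainType) :=
  {T of Complete T & Metric R T}.

(* Functions [0, +oo[ -> [0, +oo[ are encoded as total functions preserving
   nonnegativity; their values at negative reals play no role. *)
Definition Psi (R : realType) : set (R -> R) :=
  [set psi | [/\ forall t, 0 <= t -> 0 <= psi t,
                 forall s t, 0 <= s -> s <= t -> psi s <= psi t &
                 forall t, 0 < t ->
                   (\sum_(1 <= n <oo) (iter n psi t)%:E < +oo)%E]].

Definition coincidence_points (T : Type) (Y : set T) (f g : T -> T) : set T :=
  [set z | Y z /\ f z = g z].

Definition common_fixed_points (T : Type) (Y : set T) (f g : T -> T) : set T :=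
  [set z | [/\ Y z, f z = g z & g z = z]].

(* Main.v *)
Require Import Defs.
From mathcomp Require Import all_boot all_order all_algebra.
From mathcomp Require Import all_classical all_reals all_analysis.
From mathcomp Require Import lra.

Set Implicit Arguments.
Unset Strict Implicit.
Unset Printing Implicit Defensive.

Import Order.TTheory GRing.Theory Num.Theory.
Import numFieldNormedType.Exports.

Local Open Scope classical_set_scope.
Local Open Scope ring_scope.

(** This is Jungck's iteration for a pair of maps, made cyclic. Since [f] sends
    each of [A1], [A2] into the [g]-image of the other and [g] is injective,
    [f] factors on [A1 `|` A2] as [g \o h] for some [h] mapping [A1] into [A2]
    and [A2] into [A1] ([lift_through_inj]). The iterates [x n] of [h] from a
    point of [A1] satisfy [g (x n.+1) = f (x n)] and alternate between [A1] and
    [A2], so the contraction always applies to two consecutive ones.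

    Summability of the iterates of [psi] gives [psi t < t] for [t > 0]
    ([Psi_lt]). With it, the maximum in the contraction collapses along the
    iteration to the previous step ([step_le]); the n-th step of [g (x n)] is
    thus at most the n-th iterate of [psi] at a fixed positive number, and
    [g (x n)] is Cauchy ([cauchy_iterates]). Its limit is a limit of points of
    the closed set [g @` A1] and of points of the closed set [g @` A2], hence
    lies in both; by injectivity of [g] it is [g z] with [z] in [A1 `&` A2].
    If [D], the distance from [g z] to [f z], were positive, then near the
    limit the maximum would be at most [3 D / 4] and the distance from
    [f (x n)] to [f z] at least [3 D / 4], against [psi (3 D / 4) < 3 D / 4]
    ([coincidence_of_cvg]).

    At two coincidence points the maximum is just the distance of their
    [g]-images, so these images agree whenever the contraction applies. As [z]
    lies in both sets, it can be compared with every point of [A1 `|` A2]: [z]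
    is the only coincidence point. If [f] and [g] commute at [z], then [g z] is
    again a coincidence point, so [g z = z]. *)

Lemma iter_ge0 (R : realType) (psi : R -> R) (t : R) n :
  Psi psi -> 0 <= t -> 0 <= iter n psi t.
Proof. by move=> [psi0 _ _] t0; elim: n => //= n; exact: psi0. Qed.

Lemma cvg_series_iter (R : realType) (psi : R -> R) (t : R) :
  Psi psi -> 0 < t -> cvgn (series (fun n => iter n psi t)).
Proof.
move=> Ppsi t0; have it0 n := iter_ge0 n Ppsi (ltW t0).
apply: nnseries_is_cvg => //.
rewrite (nneseries_split 0 1) => [|k _]; last by rewrite lee_fin.
have [_ _ /(_ t t0) sumpsi] := Ppsi.
by rewrite add0n big_nat1 lte_add_pinfty// ltry.
Qed.

(** If [t <= psi t], monotonicity keeps every iterate at least [t], so the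
    series of iterates cannot converge. *)
Lemma Psi_lt (R : realType) (psi : R -> R) (t : R) :
  Psi psi -> 0 < t -> psi t < t.
Proof.
move=> Ppsi t0; rewrite ltNge; apply/negP => le_t_psi.
have le_t_iter n : t <= iter n psi t.
  elim: n => //= n ih; apply: le_trans le_t_psi _.
  by have [_ mono _] := Ppsi; apply: mono => //; exact: ltW.
have /cvg_series_cvg_0/cvgr0_norm_lt/(_ _ t0)[N _] := cvg_series_iter Ppsi t0.
move=> /(_ _ (leqnn N)) /=.
by rewrite ger0_norm ?(iter_ge0 _ Ppsi (ltW t0))// ltNge le_t_iter.
Qed.

Lemma Psi_ge_eq0 (R : realType) (psi : R -> R) (t : R) :
  Psi psi -> 0 <= t -> t <= psi t -> t = 0.
Proof.
move=> Ppsi; rewrite le_eqVlt => /predU1P[<-//|t0].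
by rewrite leNgt (Psi_lt Ppsi t0).
Qed.

(** By the triangle inequality, distances between terms of [u] are at most
    differences of partial sums of [b]. *)
Lemma cauchy_summable_steps (R : realType) (X : metricType R) (u : nat -> X)
    (b : nat -> R) :
  (forall n, mdist (u n) (u n.+1) <= b n) -> cvgn (series b) ->
  cauchy (u @ \oo).
Proof.
move=> ub /cvg_ex[l /= bl].
have dist_le n k : mdist (u n) (u (n + k)%N) <= series b (n + k)%N - series b n.
  elim: k => [|k ih]; first by rewrite addn0 mdistxx subrr.
  apply: le_trans (metric_triangle _ (u (n + k)%N) _) _.
  rewrite addnS seriesSr addrAC; exact: lerD.
apply: cauchy_exP => e e0.
have e20 : 0 < e / 2 by rewrite divr_gt0.
have /cvgrPdist_lt/(_ _ e20)[N _ blN] := bl.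
exists (u N); exists N => // n /= Nn.
rewrite ballEmdist /= -(subnKC Nn); apply: le_lt_trans (dist_le _ _) _.
rewrite subnKC//; have := blN _ Nn; have := blN _ (leqnn N).
by rewrite /= !ltr_norml => /andP[? ?] /andP[? ?]; lra.
Qed.

Definition gap (R : realType) (X : metricType R) (f g : X -> X) (x y : X) : R :=
  Num.max (mdist (g x) (g y))
    (Num.max ((mdist (g x) (f x) + mdist (g y) (f y)) / 2)
             ((mdist (g x) (f y) + mdist (g y) (f x)) / 2)).

Lemma gap_sym (R : realType) (X : metricType R) (f g : X -> X) (x y : X) :
  gap f g x y = gap f g y x.
Proof.
by rewrite /gap metric_sym (addrC (mdist (g x) (f x)))
           (addrC (mdist (g x) (f y))).
Qed.

Lemma gap_ge0 (R : realType) (X : metricType R) (f g : X -> X) (x y : X) :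
  0 <= gap f g x y.
Proof. by rewrite le_max mdist_ge0. Qed.

(** With [g y = f x] the crossed term is half of the distance from [g x] to
    [f y], so it and the averaged term are both at most the mean of the
    distances from [g x] to [f x] and from [f x] to [f y]. *)
Lemma gap_step (R : realType) (X : metricType R) (f g : X -> X) (x y : X) :
  g y = f x ->
  gap f g x y <= Num.max (mdist (g x) (g y)) (mdist (f x) (f y)).
Proof.
move=> gy; rewrite /gap gy mdistxx !ge_max le_max lexx/=.
have := metric_triangle (g x) (f x) (f y).
by case: (leP (mdist (g x) (f x)) (mdist (f x) (f y))) => ? ?;
  apply/andP; split; lra.
Qed.

Lemma gap_coincidence (R : realType) (X : metricType R) (f g : X -> X)
    (x y : X) :
  f x = g x -> f y = g y -> gap f g x y = mdist (g x) (g y).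
Proof.
move=> fx fy; rewrite /gap fx fy !mdistxx (metric_sym (g y) (g x)).
rewrite addr0 mul0r mulrDl -splitr (@max_r _ _ 0) ?mdist_ge0//.
exact: maxxx.
Qed.

(** In [gap_step] the maximum cannot be the left-hand distance
    [mdist (f x) (f y)] itself: a positive number is never below its image by
    [psi]. *)
Lemma step_le (R : realType) (X : metricType R) (f g : X -> X)
    (psi : R -> R) (x y : X) :
  Psi psi -> g y = f x -> mdist (f x) (f y) <= psi (gap f g x y) ->
  mdist (f x) (f y) <= psi (mdist (g x) (g y)).
Proof.
move=> Ppsi gy le_psi; have [_ mono _] := Ppsi.
have := le_trans le_psi (mono _ _ (gap_ge0 _ _ _ _) (gap_step gy)).
case: (leP (mdist (f x) _) (mdist (g x) _)) => // lt_d /(Psi_ge_eq0 Ppsi (mdist_ge0 _ _)) d0.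
by move: lt_d; rewrite d0 ltNge mdist_ge0.
Qed.

(** The steps of [g (iter n h x0)] are dominated by the iterates of [psi] at
    any positive number above the first step. *)
Lemma cauchy_iterates (R : realType) (X : metricType R) (f g h : X -> X)
    (Y : set X) (psi : R -> R) (x0 : X) :
  Psi psi -> Y x0 -> (forall x, Y x -> Y (h x)) ->
  (forall x, Y x -> g (h x) = f x) ->
  (forall x, Y x -> mdist (f x) (f (h x)) <= psi (gap f g x (h x))) ->
  cauchy ((fun n => g (iter n h x0)) @ \oo).
Proof.
move=> Ppsi Yx0 Yh gh contr; have [_ mono _] := Ppsi.
have Yx n : Y (iter n h x0) by elim: n => //= n; exact: Yh.
(* The summand 1 makes [t] positive even when the first step is zero. *)
pose t := mdist (g x0) (g (h x0)) + 1.
have t0 : 0 < t by rewrite ltr_wpDl ?mdist_ge0.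
apply: cauchy_summable_steps (cvg_series_iter Ppsi t0).
elim=> [|n ih]; first by rewrite /= lerDl.
rewrite /= (gh _ (Yx n)) (gh _ (Yx n.+1)).
apply: le_trans (step_le Ppsi (gh _ (Yx n)) (contr _ (Yx n))) _.
by apply: mono; [exact: mdist_ge0|exact: ih].
Qed.

(** A positive distance [D] between [g z] and [f z] is contradicted as soon as
    [g (x n)] and [f (x n) = g (x n.+1)] are within [D / 4] of [g z]: each term
    of the maximum is then at most [3 D / 4], whereas [f (x n)] is at distance
    at least [3 D / 4] from [f z]. *)
Lemma coincidence_of_cvg (R : realType) (X : metricType R) (f g : X -> X)
    (psi : R -> R) (x : nat -> X) (z : X) :
  Psi psi -> (forall n, g (x n.+1) = f (x n)) ->
  (forall n, mdist (f (x n)) (f z) <= psi (gap f g (x n) z)) ->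
  g (x n) @[n --> \oo] --> g z -> f z = g z.
Proof.
move=> Ppsi gx contr gxz; have [_ mono _] := Ppsi.
apply/esym/eqP; apply: contraT; rewrite -mdist_gt0.
set D := mdist (g z) (f z) => D0.
have D40 : 0 < D / 4 by rewrite divr_gt0.
have [N _ near_z] := metricType_numDomainType.cvgr_dist_lt gxz D40.
have dx := near_z _ (leqnn N); have dfx := near_z _ (leqnSn N).
rewrite /= gx in dfx; rewrite /= in dx.
have gap_le : gap f g (x N) z <= D * 3 / 4.
  have := metric_triangle (g (x N)) (g z) (f z).
  have := metric_triangle (g (x N)) (g z) (f (x N)).
  rewrite /gap -/D (metric_sym (g (x N)) (g z)) => ? ?.
  by rewrite !ge_max; apply/and3P; split; lra.
have le_psi := le_trans (contr N) (mono _ _ (gap_ge0 _ _ _ _) gap_le).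
have lt_psi : psi (D * 3 / 4) < D * 3 / 4 by apply: Psi_lt => //; lra.
have := metric_triangle (g z) (f (x N)) (f z); rewrite -/D => ?.
by exfalso; lra.
Qed.

Lemma cvg_subindex (k : nat -> nat) :
  (forall n, (n <= k n)%N) -> k @ \oo --> \oo.
Proof.
move=> le_k A [N _ NA]; exists N => // n /= Nn; apply: NA => /=.
exact: leq_trans Nn (le_k n).
Qed.

Lemma closed_alternating (T : topologicalType) (B C : set T) (u : nat -> T)
    (l : T) :
  closed B -> closed C -> (forall n, if odd n then C (u n) else B (u n)) ->
  u @ \oo --> l -> (B `&` C) l.
Proof.
move=> Bc Cc uBC ul.
have le_double n : (n <= n.*2)%N by rewrite -addnn leq_addr.
split.
  apply: (closed_cvg _ Bc _ _ (cvg_comp _ _ (cvg_subindex le_double) ul)).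
  by apply: nearW => n /=; have := uBC n.*2; rewrite odd_double.
have le_doubleS n : (n <= n.*2.+1)%N by rewrite leqW.
apply: (closed_cvg _ Cc _ _ (cvg_comp _ _ (cvg_subindex le_doubleS) ul)).
by apply: nearW => n /=; have := uBC n.*2.+1; rewrite /= odd_double.
Qed.

(** Injectivity is what makes a single [h] serve both sets: on a point of
    [A `&` B], the preimage found in [B] and the one found in [A] coincide. *)
Lemma lift_through_inj (T : choiceType) (A B : set T) (f g : T -> T) (t0 : T) :
  set_inj (A `|` B) g -> f @` A `<=` g @` B -> f @` B `<=` g @` A ->
  exists h : T -> T, [/\ forall x, (A `|` B) x -> g (h x) = f x,
    forall x, A x -> B (h x) & forall x, B x -> A (h x)].
Proof.
move=> g_inj fA fB.
have ex x : exists y, (A `|` B) x -> [/\ g y = f x, A x -> B y & B x -> A y].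
  have [Yx|nYx] := pselect ((A `|` B) x); last by exists t0.
  have hA : A x -> exists2 y, B y & g y = f x by move=> ?; apply: fA; exists x.
  have hB : B x -> exists2 y, A y & g y = f x by move=> ?; apply: fB; exists x.
  have [Ax|nAx] := pselect (A x); last first.
    have [//|Bx] := Yx; have [y Ay gy] := hB Bx.
    by exists y => _; split.
  have [y By gy] := hA Ax; exists y => _; split=> // /hB[y' Ay' gy'].
  rewrite (g_inj y y') ?inE ?gy ?gy'//; [by right|by left].
have [h hP] := choice ex; exists h; split=> x Hx.
- by have [] := hP x Hx.
- by have [_ + _] := hP x (or_introl Hx); apply.
- by have [_ _ +] := hP x (or_intror Hx); apply.
Qed.

Theorem corollary4p17 (R : realType) (X : completeMetricType R)
    (A1 A2 : set X) (A1_neq0 : A1 !=set0) (A2_neq0 : A2 !=set0)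
    (A1_closed : closed A1) (A2_closed : closed A2)
    (f g : {fun (A1 `|` A2) >-> (A1 `|` A2)})
    (gA1_closed : closed (g @` A1)) (gA2_closed : closed (g @` A2))
    (fA1 : f @` A1 `<=` g @` A2) (fA2 : f @` A2 `<=` g @` A1)
    (g_inj : set_inj (A1 `|` A2) g)
    (contr : exists2 psi : R -> R, Psi psi &
      forall x y : X, A1 x -> A2 y ->
        mdist (f x) (f y) <=
          psi (Num.max (mdist (g x) (g y))
                (Num.max ((mdist (g x) (f x) + mdist (g y) (f y)) / 2)
                         ((mdist (g x) (f y) + mdist (g y) (f x)) / 2)))) :
  (exists2 z, coincidence_points (A1 `|` A2) f g z & (A1 `&` A2) z) /\
  ((forall x, coincidence_points (A1 `|` A2) f g x -> f (g x) = g (f x)) ->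
   (exists! z, common_fixed_points (A1 `|` A2) f g z) /\
   common_fixed_points (A1 `|` A2) f g `<=` A1 `&` A2).
Proof.
have [psi Ppsi contr12] := contr.
have contr' x y : A1 x /\ A2 y \/ A2 x /\ A1 y ->
    mdist (f x) (f y) <= psi (gap f g x y).
  by case=> -[? ?]; [|rewrite metric_sym gap_sym]; exact: contr12.
have [x0 A1x0] := A1_neq0.
have [h [gh hA1 hA2]] := lift_through_inj x0 g_inj fA1 fA2.
pose x n := iter n h x0.
have xA n : if odd n then A2 (x n) else A1 (x n).
  by elim: n => //= n; case: (odd n) => /=; [exact: hA2|exact: hA1].
have hY y : (A1 `|` A2) y -> (A1 `|` A2) (h y).
  by case=> ?; [right; exact: hA1|left; exact: hA2].
have Yx n : (A1 `|` A2) (x n) by have := xA n; case: odd; [right|left].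
have /cauchy_cvg/cvg_ex[l /= gxl] : cauchy ((g \o x) @ \oo).
  apply: (cauchy_iterates Ppsi (Yx 0%N) hY gh) => y Yy; apply: contr'.
  by case: Yy => Ay; [left|right]; split=> //; [exact: hA1|exact: hA2].
have [[z A1z gz] [z' A2z' gz']] : (g @` A1 `&` g @` A2) l.
  apply: closed_alternating gA1_closed gA2_closed _ gxl => n.
  by have := xA n; case: odd => ? /=; exists (x n).
have zz' : z' = z by apply: g_inj; rewrite ?inE ?gz ?gz'//; [right|left].
have A2z : A2 z by rewrite -zz'.
have fz : f z = g z.
  apply: (coincidence_of_cvg (x := x) Ppsi); last by rewrite gz.
    by move=> n; rewrite /x iterS gh//; exact: Yx.
  by move=> n; apply: contr'; case: (Yx n) => ?; [left|right].
(* [z] lies in both sets, so the contraction compares it with every [w]. *)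
have coin_uniq w : coincidence_points (A1 `|` A2) f g w -> w = z.
  move=> [Yw fw]; apply: g_inj; rewrite ?inE//; first by left.
  have := contr' w z; rewrite gap_coincidence// fw fz => le_psi.
  apply: mdist_positivity; apply: (Psi_ge_eq0 Ppsi (mdist_ge0 _ _)).
  by apply: le_psi; case: Yw => ?; [left|right].
have coinz : coincidence_points (A1 `|` A2) f g z by split=> //; left.
split; first by exists z.
move=> comm.
have fix_uniq w : common_fixed_points (A1 `|` A2) f g w -> w = z.
  by move=> [Yw fw _]; exact: coin_uniq.
have ggz : g z = z.
  apply: coin_uniq; split; last by rewrite comm// fz.
  by apply: funS; left.
split=> [|w /fix_uniq ->//]; exists z; split; first by split=> //; left.
by move=> w /fix_uniq.
Qed.
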